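(* The number $\zeta(3)=\sum_{n=1}^\infty \frac{1}{n^3}$ is irrational.
   Context: $\zeta(s)=\sum_{n=1}^\infty n^{-s}$ denotes Riemann's zeta function. *)

(* Defs.v *)
From mathcomp Require Import all_boot all_order all_algebra.
From mathcomp Require Import all_classical all_reals all_analysis.

Set Implicit Arguments.
Unset Strict Implicit.
Unset Printing Implicit Defensive.

Import Order.TTheory GRing.Theory Num.Theory.
Import numFieldNormedType.Exports.

Local Open Scope classical_set_scope.
Local Open Scope ring_scope.

(* The Dirichlet series of Riemann's zeta function at a real argument s.
   The sum is a [lim], hence meaningful only where the series
   converges, i.e. for s > 1. *)
Definition zeta (R : realType) (s : R) : R :=
  limn (fun N => \sum_(1 <= n < N.+1) n%:R `^ (- s)).

(* Main.v *)
Require Import Defs.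
From mathcomp Require Import all_boot all_order all_algebra.
From mathcomp Require Import all_classical all_reals all_analysis.
From mathcomp Require Import ring lra zify.

Set Implicit Arguments.
Unset Strict Implicit.
Unset Printing Implicit Defensive.

(* Apery's proof. The numbers
     a_n = sum_k C(n,k)^2 C(n+k,k)^2   and
     b_n = sum_k C(n,k)^2 C(n+k,k)^2 c_(n,k),
     c_(n,k) = sum_(m <= n) 1/m^3
               + sum_(m <= k) (-1)^(m-1) / (2 m^3 C(n,m) C(n+m,m)),
   both satisfy
     (n+1)^3 u_(n+1) - (34 n^3 + 51 n^2 + 27 n + 5) u_n + n^3 u_(n-1) = 0.
   Their Casoratian is therefore 6/n^3, so that b_n / a_n increases to zeta(3)
   with 0 < a_n zeta(3) - b_n <= 12 / a_n, while the recurrence forces a_n to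
   grow at least like 33^n. On the other hand 2 lcm(1..n)^3 b_n is an integer
   and lcm(1..n) = O((16/5)^n), where (16/5)^3 = 32.768 < 33. If zeta(3) = p/d,
   then 2 d lcm(1..n)^3 (a_n zeta(3) - b_n) would be a positive integer tending
   to 0.
   The bound on the lcm comes from n! / ([n/2]! [n/3]! [n/7]! [n/42]!), whose
   product with lcm(1..[n/42]) is divisible by lcm(1..n). *)

(** * Growth of lcm(1..n) *)

Definition lcm_upto (n : nat) : nat := \big[lcmn/1]_(1 <= m < n.+1) m.

Lemma dvdn_lcm_upto m n : 0 < m <= n -> m %| lcm_upto n.
Proof.
move=> /andP[m_gt0 le_mn]; rewrite /lcm_upto.
elim: n le_mn => [|n IHn] le_mn; first by lia.
rewrite big_nat_recr //=; move: le_mn; rewrite leq_eqVlt => /orP[/eqP->|].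
  exact: dvdn_lcmr.
by rewrite ltnS => /IHn /dvdn_trans; apply; apply: dvdn_lcml.
Qed.

Lemma lcm_upto_dvdn n d :
  (forall m, 0 < m <= n -> m %| d) -> lcm_upto n %| d.
Proof.
rewrite /lcm_upto; elim: n => [|n IHn] Hd; first by rewrite big_geq.
rewrite big_nat_recr //= dvdn_lcm; apply/andP; split; last by apply: Hd; rewrite leqnn.
by apply: IHn => m /andP[m0 mn]; apply: Hd; rewrite m0 ltnW.
Qed.

Lemma lcm_upto_gt0 n : 0 < lcm_upto n.
Proof.
rewrite /lcm_upto; elim: n => [|n IHn]; first by rewrite big_geq.
by rewrite big_nat_recr //= lcmn_gt0 IHn.
Qed.

Lemma lcm_upto_dvd m n : m <= n -> lcm_upto m %| lcm_upto n.
Proof.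
move=> le_mn; apply: lcm_upto_dvdn => k /andP[k0 km].
by apply: dvdn_lcm_upto; rewrite k0 (leq_trans km).
Qed.

(** Legendre's formula with a free cutoff: the terms with p^k > m vanish, so several factorials can
    share one range of summation. *)
Lemma logn_fact_wide p m N :
  prime p -> m < N -> logn p m`! = \sum_(1 <= k < N) m %/ p ^ k.
Proof.
move=> pp lt_mN; rewrite logn_fact // [RHS](@big_cat_nat _ _ _ m.+1) //=.
rewrite [X in _ + X]big_nat_cond [X in _ + X]big1 ?addn0 // => k.
move=> /andP[/andP[mk _] _]; apply: divn_small.
by apply: leq_trans mk _; apply/ltnW/ltn_expl/prime_gt1.
Qed.

Lemma sum_indicator a b N :
  a <= b < N -> \sum_(1 <= k < N) ((a < k) && (k <= b) : nat) = b - a.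
Proof.
move=> /andP[le_ab lt_bN].
elim: N b le_ab lt_bN => [|N IHN] // b le_ab lt_bN.
case: N IHN lt_bN => [|N] IHN lt_bN; first by rewrite big_geq //; lia.
rewrite big_nat_recr //=.
have [lt_bN'|ge_bN] := ltnP b N.+1.
  by rewrite IHN // [_ && _]negbTE; lia.
have -> : b = N.+1 by lia.
rewrite andbT; have [lt_aN|ge_aN] := ltnP a N.+1.
  have : \sum_(1 <= k < N.+1) ((a < k) && (k <= N) : nat) = N - a.
    by apply: IHN; lia.
  rewrite (eq_big_nat _ _ (F2 := fun k => (a < k) && (k <= N.+1) : nat)).
    by move=> ->; lia.
  by move=> k /andP[_ kN]; congr (nat_of_bool _); lia.
rewrite big_nat_cond big1; first by lia.
by move=> k /andP[/andP[_ kN] _]; rewrite [_ && _]negbTE; lia.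
Qed.

Definition multinomial4 a b c d : nat :=
  'C(a + b, b) * 'C(a + b + c, c) * 'C(a + b + c + d, d).

Lemma multinomial4_fact a b c d :
  multinomial4 a b c d * (a`! * b`! * c`! * d`!) = (a + b + c + d)`!.
Proof.
have B m k : 'C(m + k, k) * (k`! * m`!) = (m + k)`!.
  by have := @bin_fact (m + k) k; rewrite addnK; apply; lia.
rewrite /multinomial4 -[RHS]B -[(a + b + c)`!]B -[(a + b)`!]B; lia.
Qed.

(** The left side is a single term of the binomial expansion of the right side. *)
Lemma bin_weight_le x y m k : 'C(m + k, k) * (x ^ m * y ^ k) <= (x + y) ^ (m + k).
Proof.
rewrite expnDn (bigD1 (inord k)) //= inordK; last by lia.
by rewrite addnK leq_addr.
Qed.

(* The weights 21/42, 14/42, 6/42, 1/42 are the frequencies 1/2, 1/3, 1/7, 1/42. *)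
Lemma multinomial4_le a b c d :
  multinomial4 a b c d <= 2 ^ a * 3 ^ b * 7 ^ c * 42 ^ d.
Proof.
(* The weights are merged one at a time: 21 + 14 = 35, 35 + 6 = 41, 41 + 1 = 42. *)
have H1 := bin_weight_le 21 14 a b.
have H2 := bin_weight_le 35 6 (a + b) c.
have H3 := bin_weight_le 41 1 (a + b + c) d.
have pos : 0 < 21 ^ a * 14 ^ b * 6 ^ c by rewrite !muln_gt0 !expn_gt0.
rewrite -(leq_pmul2r pos).
have -> : 2 ^ a * 3 ^ b * 7 ^ c * 42 ^ d * (21 ^ a * 14 ^ b * 6 ^ c)
   = 42 ^ (a + b + c + d).
  have E2 : 42 ^ a = 2 ^ a * 21 ^ a by rewrite -expnMn.
  have E3 : 42 ^ b = 3 ^ b * 14 ^ b by rewrite -expnMn.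
  have E7 : 42 ^ c = 7 ^ c * 6 ^ c by rewrite -expnMn.
  rewrite !expnD E2 E3 E7; lia.
rewrite exp1n muln1 in H3; apply: leq_trans H3.
rewrite /multinomial4 [X in X <= _](_ : _ = 'C(a + b + c + d, d) *
  ('C(a + b + c, c) * ('C(a + b, b) * (21 ^ a * 14 ^ b) * 6 ^ c))); last by lia.
rewrite leq_mul2l; apply/orP; right.
apply: leq_trans H2; rewrite leq_mul2l; apply/orP; right.
by rewrite leq_mul2r H1 orbT.
Qed.

(* 1/2 + 1/3 + 1/7 + 1/42 = 1, while 1/2 + 1/3 + 1/7 = 41/42. *)
Lemma floor_sylvester y :
  y %/ 2 + y %/ 3 + y %/ 7 + y %/ 42 + ((0 < y) && (y < 42)) <= y.
Proof. by case: (ltnP 0 y) => ?; case: (ltnP y 42) => ? /=; lia. Qed.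

(** Valuations are compared at each prime p. By Legendre's formula and [floor_sylvester] at y = n %/
    p^k, the cofactor of [lcm_upto (n %/ 42)] gains a factor p for every k with p^k <= n and n %/ 42
    < p^k; the smaller exponents are supplied by the lcm of the numbers up to n %/ 42. *)
Lemma lcm_upto_step_dvd n :
  lcm_upto n %| lcm_upto (n %/ 42) *
    (multinomial4 (n %/ 2) (n %/ 3) (n %/ 7) (n %/ 42) *
       n ^_ (n - (n %/ 2 + n %/ 3 + n %/ 7 + n %/ 42))).
Proof.
set a := n %/ 2; set b := n %/ 3; set c := n %/ 7; set d := n %/ 42.
set s := a + b + c + d.
have le_sn : s <= n by rewrite /s /a /b /c /d; lia.
(* [M] is n! / (a! b! c! d!): the multinomial accounts for s!, the falling factorial for n! / s!. *)
set M := multinomial4 _ _ _ _ * _.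
have M_fact : M * (a`! * b`! * c`! * d`!) = n`!.
  rewrite /M mulnAC multinomial4_fact mulnC -/s.
  by rewrite -[s in s`!](subKn le_sn) ffact_fact // leq_subr.
have M_gt0 : 0 < M.
  by have := fact_gt0 n; rewrite -M_fact muln_gt0 => /andP[].
have ld_gt0 := lcm_upto_gt0 d.
apply: lcm_upto_dvdn => m /andP[m_gt0 le_mn].
have n_gt0 : 0 < n by exact: leq_trans le_mn.
apply/dvdn_partP => // p; rewrite mem_primes => /andP[pp _].
have p_gt1 := prime_gt1 pp.
have lM_gt0 : 0 < lcm_upto d * M by rewrite (leq_mul ld_gt0 M_gt0).
rewrite p_part pfactor_dvdn //.
rewrite lognM //.
set L := trunc_log p n; set L' := trunc_log p d.
have mL : logn p m <= L.
  apply: trunc_log_max => //; apply: leq_trans le_mn.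
  by apply: dvdn_leq => //; apply: pfactor_dvdnn.
have lL : L' <= logn p (lcm_upto d).
  rewrite -pfactor_dvdn //; have [d0|d_gt0] := posnP d.
    by rewrite /L' d0 trunc_log0 expn0 dvd1n.
  by apply: dvdn_lcm_upto; rewrite expn_gt0 ltnW //= trunc_logP.
suff ML : L <= L' + logn p M by apply: leq_trans mL (leq_trans ML _); rewrite leq_add2r.
have le_L'L : L' <= L by apply: leq_trunc_log; rewrite /d; lia.
have L_lt : L < n.+1.
  by rewrite ltnS; apply: leq_trans (trunc_logP p_gt1 n_gt0); apply/ltnW/ltn_expl.
have : logn p M + (logn p a`! + logn p b`! + logn p c`! + logn p d`!) = logn p n`!.
  rewrite -M_fact (lognM _ M_gt0) ?muln_gt0 ?fact_gt0 //; congr (_ + _).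
  by rewrite !lognM ?muln_gt0 ?fact_gt0.
rewrite !(@logn_fact_wide p _ n.+1) // ?/a ?/b ?/c ?/d; [|lia..].
rewrite -!big_split /= => E.
have : \sum_(1 <= k < n.+1) (n %/ 2 %/ p ^ k + n %/ 3 %/ p ^ k + n %/ 7 %/ p ^ k
     + n %/ 42 %/ p ^ k) + (L - L') <= \sum_(1 <= k < n.+1) n %/ p ^ k.
  (* [L - L'] is spread over the exponents k with L' < k <= L, so that the inequality can be checked
     term by term. *)
  rewrite -(@sum_indicator _ _ n.+1) ?le_L'L // -big_split /=.
  rewrite !big_nat; apply: leq_sum => k /andP[k_gt0 kn].
  rewrite ![n %/ _ %/ p ^ k]divnAC.
  apply: leq_trans (floor_sylvester _); rewrite leq_add2l.
  case: andP => // -[L'k kL]; rewrite lt0b; apply/andP; split.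
    rewrite divn_gt0 ?expn_gt0 ?(ltnW p_gt1) //.
    by apply: leq_trans (trunc_logP p_gt1 n_gt0); rewrite leq_pexp2l // ltnW.
  rewrite ltn_divLR ?expn_gt0 ?(ltnW p_gt1) // mulnC -ltn_divLR //.
  apply: leq_trans (trunc_log_ltn _ p_gt1) _.
  by rewrite leq_pexp2l // ltnW.
rewrite -E; lia.
Qed.

Lemma lcm_upto_step n : 0 < n ->
  lcm_upto n <= lcm_upto (n %/ 42) *
    (2 ^ (n %/ 2) * 3 ^ (n %/ 3) * 7 ^ (n %/ 7) * 42 ^ (n %/ 42) * n ^ 3).
Proof.
move=> n_gt0.
set s := n %/ 2 + n %/ 3 + n %/ 7 + n %/ 42.
have le_sn : s <= n by rewrite /s; lia.
(* n - s is the sum of the four fractional parts, at most 1/2 + 2/3 + 6/7 + 41/42 = 3. *)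
have ge_sn : n - s <= 3 by rewrite /s; lia.
have le_ff : n ^_ (n - s) <= n ^ 3.
  apply: (@leq_trans (n ^ (n - s))); last by rewrite leq_pexp2l.
  rewrite ffact_prod -[X in _ <= _ ^ X]card_ord -prod_nat_const.
  by apply: leq_prod => i _; apply: leq_subr.
have ff_gt0 : 0 < n ^_ (n - s) by rewrite ffact_gt0 leq_subr.
have m_gt0 : 0 < multinomial4 (n %/ 2) (n %/ 3) (n %/ 7) (n %/ 42).
  by rewrite /multinomial4 !muln_gt0 !bin_gt0; lia.
apply: leq_trans (dvdn_leq _ (lcm_upto_step_dvd n)) _.
  exact: leq_mul (lcm_upto_gt0 _) (leq_mul m_gt0 ff_gt0).
by rewrite leq_mul2l leq_mul ?orbT ?multinomial4_le.
Qed.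

(** Absorbs the factor n^3 of [lcm_upto_step] after a 42nd power, 126 = 3 * 42. The threshold 2^11
    comes from 126 * (t + 1) <= 2^t, which holds from t = 11 on. *)
Lemma expn_126_le n : 2 ^ 11 <= n -> n ^ 126 <= 2 ^ n.
Proof.
move=> n_ge.
have n_gt0 : 0 < n by apply: leq_trans n_ge; rewrite expn_gt0.
set t := trunc_log 2 n.
have t_ge : 11 <= t by apply: trunc_log_max.
have key : 126 * t.+1 <= 2 ^ t.
  rewrite -(subnK t_ge); elim: (t - 11) => [|k IHk]; first by [].
  by rewrite addSn expnS; lia.
apply: (@leq_trans ((2 ^ t.+1) ^ 126)).
  by rewrite leq_exp2r // ltnW // trunc_log_ltn.
rewrite -expnM leq_pexp2l // mulnC; apply: leq_trans key _.
exact: trunc_logP.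
Qed.

(** Follows from 5^3 <= 2^7, 5^2 <= 2^5, 3^5 <= 2^8 and 7 <= 2^3; the exponents of 2 add up to
    exactly 164 = 4 * 41. The final factor 2 on the left leaves room for n^126 <= 2^n. *)
Lemma sylvester_growth_le : 2 ^ 21 * 3 ^ 14 * 7 ^ 6 * 42 * 5 ^ 41 * 2 <= 16 ^ 41.
Proof.
have pow_le a k j m : a ^ k <= 2 ^ j -> a ^ (k * m) <= 2 ^ (j * m).
  by rewrite !expnM; case: m => // m; rewrite leq_exp2r.
have E5 : 5 ^ (3 * 13 + 2) <= 2 ^ (7 * 13 + 5).
  rewrite (expnD 5) (expnD 2); apply: leq_mul; last exact: isT.
  exact: (pow_le 5 3 7 13 isT).
have E3 : 3 ^ 15 <= 2 ^ (8 * 3) by exact: (pow_le 3 5 8 3 isT).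
have E7 : 7 ^ 7 <= 2 ^ (3 * 7) by exact: (pow_le 7 1 3 7 isT).
have pow16 m a b c d : 4 * m = a.+2 + (b + c + d) ->
    16 ^ m = 2 ^ a * 2 * 2 * (2 ^ b * 2 ^ c * 2 ^ d).
  by move=> E; rewrite -!expnSr -!expnD -E expnM.
have regroup u x : u * 3 ^ 14 * 7 ^ 6 * 42 * x * 2 = u * 2 * 2 * (3 ^ 15 * 7 ^ 7 * x).
  by rewrite (expnS 3 14) (expnS 7 6); move: (3 ^ 14) (7 ^ 6) => *; lia.
rewrite regroup (@pow16 41 21 (8 * 3) (3 * 7) (7 * 13 + 5) (erefl _)).
rewrite leq_mul2l; apply/orP; right.
exact: leq_mul (leq_mul E3 E7) E5.
Qed.

(** The 42nd power removes the floors, since 42 * (n %/ 2) <= 21 * n and likewise for 3, 7 and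
    42. *)
Lemma lcm_upto_step42 n : 0 < n ->
  lcm_upto n ^ 42 <=
  lcm_upto (n %/ 42) ^ 42 *
    (2 ^ (21 * n) * 3 ^ (14 * n) * 7 ^ (6 * n) * 42 ^ n * n ^ (3 * 42)).
Proof.
move=> n_gt0.
have := lcm_upto_step n_gt0; rewrite -(@leq_exp2r _ _ 42) //.
move=> /leq_trans; apply.
rewrite expnMn leq_mul2l; apply/orP; right.
rewrite (expnMn _ (n ^ 3)) -(expnM n) leq_mul2r; apply/orP; right.
rewrite !expnMn -!expnM.
by apply: leq_mul; [apply: leq_mul; [apply: leq_mul|]|]; rewrite leq_pexp2l //; lia.
Qed.

(** Strong induction from n %/ 42 to n, comparing 42nd powers. As 42 * (n %/ 42) <= n, the induction
    hypothesis costs only one of the 42 factors (16/5)^n and returns the same constant; the other 41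
    pay for the step. *)
Lemma lcm_upto_le :
  exists C, forall n, 5 ^ n * lcm_upto n <= C * 16 ^ n.
Proof.
pose N0 := 2 ^ 11.
(* Dominates [lcm_upto] on the base range n < 2^11. *)
pose C := (\sum_(i < N0) lcm_upto i).+1.
have le_pow k : 5 ^ k <= 16 ^ k by case: k => // k; rewrite leq_exp2r.
exists C => n; elim/ltn_ind: n => n IHn.
have [ltn_N0|n_ge] := ltnP n N0.
  rewrite mulnC; apply: leq_mul; last exact: le_pow.
  rewrite /C (bigD1 (Ordinal ltn_N0)) //=; lia.
have n_gt0 : 0 < n by apply: leq_trans n_ge; rewrite /N0 expn_gt0.
have lt_mn : n %/ 42 < n by lia.
have := IHn _ lt_mn; set m := n %/ 42 => IHm.
have le_mn : 42 * m <= n by rewrite /m; lia.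
rewrite -(@leq_exp2r _ _ 42) // !expnMn.
have y_le : 5 ^ n * lcm_upto m ^ 42 <= C ^ 42 * 16 ^ n.
  move: IHm; rewrite -(@leq_exp2r _ _ 42) // !expnMn -!expnM ![m * 42]mulnC => IHm.
  rewrite -(subnK le_mn) (expnD 5) (expnD 16) -mulnA [X in _ <= X]mulnCA.
  exact: leq_mul (le_pow _) IHm.
have pow42 x : (x ^ n) ^ 42 = (x ^ 41) ^ n * x ^ n by rewrite expnSr expnAC.
rewrite !pow42.
have growth : 2 ^ (21 * n) * 3 ^ (14 * n) * 7 ^ (6 * n) * 42 ^ n * (5 ^ 41) ^ n * 2 ^ n
    <= (16 ^ 41) ^ n.
  rewrite !(expnM _ _ n) -!expnMn (leq_exp2r _ _ n_gt0); exact: sylvester_growth_le.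
have x_le := lcm_upto_step42 n_gt0; rewrite -/m in x_le.
have n_le : n ^ (3 * 42) <= 2 ^ n := expn_126_le n_ge.
have combine D y x f s t u p q c : f * y <= c * s -> D * p * t <= q ->
    x <= y * (D * u) -> u <= t -> p * f * x <= c * (q * s).
  move=> {}y_le {}growth {}x_le {}n_le.
  apply: (@leq_trans (p * f * (y * (D * t)))).
    by rewrite leq_mul2l (leq_trans x_le) ?orbT // !leq_mul.
  rewrite (_ : _ * _ = (D * p * t) * (f * y)); last by lia.
  by rewrite [X in _ <= X]mulnCA; apply: leq_mul.
exact: combine y_le growth x_le n_le.
Qed.

(** * The recurrence of the Apery numbers *)

Import Order.TTheory GRing.Theory Num.Theory.
Import numFieldNormedType.Exports.

Local Open Scope classical_set_scope.
Local Open Scope ring_scope.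

Definition apery_bin (n k : nat) : nat := 'C(n, k) * 'C(n + k, k).

Definition apery_a (n : nat) : nat := \sum_(0 <= k < n.+1) apery_bin n k ^ 2.

Section AperyRecurrence.
Variable R : realFieldType.

(** The second sum is indexed from 0: its term [m] is the term m + 1 of the usual formula, whence
    the sign (-1)^m. *)
Definition apery_c (n k : nat) : R :=
  \sum_(1 <= m < n.+1) (m%:R ^+ 3)^-1
  + \sum_(0 <= m < k) (-1) ^+ m / (2 * m.+1%:R ^+ 3 * (apery_bin n m.+1)%:R).

Definition apery_b (n : nat) : R :=
  \sum_(0 <= k < n.+1) (apery_bin n k)%:R ^+ 2 * apery_c n k.

Local Notation lam n k := ((apery_bin n k)%:R : R).

Lemma apery_bin_small n k : (n < k)%N -> apery_bin n k = 0%N.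
Proof. by move=> lt_nk; rewrite /apery_bin bin_small. Qed.

Lemma apery_bin_gt0 n k : (k <= n)%N -> (0 < apery_bin n k)%N.
Proof. by move=> le_kn; rewrite /apery_bin muln_gt0 !bin_gt0 le_kn leq_addl. Qed.

Lemma apery_bin0 n : apery_bin n 0 = 1%N.
Proof. by rewrite /apery_bin !bin0. Qed.

(** Cleared of denominators, so that it holds for every k, including those where the binomials
    vanish. *)
Lemma apery_bin_recl n k :
  lam n.+1 k * (n%:R + 1 - k%:R) = lam n k * (n%:R + 1 + k%:R).
Proof.
have [le_k|lt_k] := leqP k n.+1; last first.
  by rewrite !apery_bin_small ?mul0r //; lia.
have E1 := mul_bin_down n.+1 k; have E2 := mul_bin_down (n.+1 + k) k.
rewrite addnK addSn /= in E1 E2.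
have -> : n%:R + 1 - k%:R = (n.+1 - k)%:R :> R by rewrite natrB // -natr1.
have -> : n%:R + 1 + k%:R = (n + k).+1%:R :> R by rewrite -natr1 natrD; ring.
rewrite -!natrM; congr (_%:R); rewrite /apery_bin addSn.
by nia.
Qed.

Lemma apery_bin_recr n k :
  lam n k.+1 * (k%:R + 1) ^+ 2 = lam n k * (n%:R - k%:R) * (n%:R + k%:R + 1).
Proof.
have [le_k|lt_k] := leqP k n; last first.
  by rewrite !apery_bin_small ?mul0r //; lia.
have E1 := mul_bin_left n k; have E2 := mul_bin_diag (n + k).+1 k.
rewrite /= in E1 E2.
rewrite -natrB // -natrD !natr1 -!natrM expr2 -!natrM; congr (_%:R).
by rewrite /apery_bin addnS; nia.
Qed.

(** At k = 0 the value is 0, as for binomials with a negative lower index, and not the value at a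
    truncated predecessor. *)
Definition apery_bin_pred n k : nat := if k is k'.+1 then apery_bin n k' else 0.

(* All the shifts of the summand entering the recurrence are polynomial
   multiples of t = (n+k)! / ((n+2-k)! k!^2). *)
Lemma apery_bin_param n k : exists t : R, [/\
  lam n.+2 k = t * (n%:R + 1 + k%:R) * (n%:R + 2 + k%:R),
  lam n.+1 k = t * (n%:R + 1 + k%:R) * (n%:R + 2 - k%:R),
  lam n k = t * (n%:R + 1 - k%:R) * (n%:R + 2 - k%:R) &
  (apery_bin_pred n.+1 k)%:R = t * k%:R ^+ 2].
Proof.
have n0 : 0 <= n%:R :> R by []. have k0 : 0 <= k%:R :> R by [].
have d1 : n%:R + 1 + k%:R != 0 :> R by rewrite gt_eqF //; lra.
have d2 : n%:R + 2 + k%:R != 0 :> R by rewrite gt_eqF //; lra.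
have E1 := apery_bin_recl n.+1 k; have E2 := apery_bin_recl n k.
rewrite -[n.+1%:R]natr1 in E1.
(* The first equation is solved for t because its factors are nonzero for every k, unlike n + 1 - k
   and n + 2 - k. *)
exists (lam n.+2 k / ((n%:R + 1 + k%:R) * (n%:R + 2 + k%:R))).
have F1 : lam n.+1 k = lam n.+2 k * (n%:R + 2 - k%:R) / (n%:R + 2 + k%:R).
  apply: (mulIf d2); rewrite mulfVK //.
  transitivity (lam n.+1 k * (n%:R + 1 + 1 + k%:R)); first by ring.
  by rewrite -E1; ring.
have F2 : lam n k = lam n.+1 k * (n%:R + 1 - k%:R) / (n%:R + 1 + k%:R).
  by apply: (mulIf d1); rewrite mulfVK.
split; first by field; rewrite d1 d2.
- by rewrite F1; field; rewrite d1 d2.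
- by rewrite F2 F1; field; rewrite d1 d2.
case: k k0 d1 d2 {E1 E2 F1 F2} => [|k] k0 d1 d2 /=; first by rewrite expr0n mulr0.
have E1 := apery_bin_recl n.+1 k; have E3 := apery_bin_recr n.+2 k.
rewrite -[k.+1%:R]natr1 in d1 d2 *; rewrite -[n.+2%:R]natr1 -[n.+1%:R]natr1 in E1 E3.
rewrite mulrAC E3.
apply: (mulIf (mulf_neq0 d1 d2)); rewrite mulfVK ?mulf_neq0 //.
transitivity (lam n.+1 k * (n%:R + 1 + 1 + k%:R) * (n%:R + 2 + (k%:R + 1))).
  by ring.
by rewrite -E1; ring.
Qed.

Definition apery_poly (x : R) : R := 34 * x ^+ 3 + 51 * x ^+ 2 + 27 * x + 5.

(* Zagier's certificate, shifted by one in k so that it vanishes at k = 0. *)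
Definition apery_cert n k : R :=
  let x := n%:R in let y := k%:R in
  4 * (2 * x + 1) * ((y - 1) * (2 * y - 1) - (2 * x + 1) ^+ 2)
    * (apery_bin_pred n k)%:R ^+ 2.

(** Creative telescoping: in terms of the parameter t both sides are t^2 times a polynomial in n and
    k. *)
Lemma apery_certP n k :
  n.+2%:R ^+ 3 * lam n.+2 k ^+ 2 - apery_poly n.+1%:R * lam n.+1 k ^+ 2
  + n.+1%:R ^+ 3 * lam n k ^+ 2 = apery_cert n.+1 k.+1 - apery_cert n.+1 k.
Proof.
have [t [E2 E1 E0 Ep]] := apery_bin_param n k.
rewrite /apery_cert /= Ep E2 E1 E0 /apery_poly.
rewrite -[n.+2%:R]natr1 -[n.+1%:R]natr1 -[k.+1%:R]natr1.
by ring.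
Qed.

Lemma apery_sum_widen (f : nat -> R) n m : (n < m)%N ->
  \sum_(0 <= k < n.+1) lam n k ^+ 2 * f k = \sum_(0 <= k < m) lam n k ^+ 2 * f k.
Proof.
move=> lt_nm; rewrite [RHS](@big_cat_nat _ _ _ n.+1) //=.
rewrite [X in _ = _ + X]big_nat_cond [X in _ = _ + X]big1 ?addr0 // => k.
move=> /andP[/andP[lt_nk _] _].
by rewrite apery_bin_small // expr0n mul0r.
Qed.

Lemma apery_aE n m : (n < m)%N ->
  (apery_a n)%:R = \sum_(0 <= k < m) lam n k ^+ 2 :> R.
Proof.
move=> lt_nm; rewrite /apery_a natr_sum.
have := apery_sum_widen (fun=> 1) lt_nm; rewrite -!mulr_suml !mulr1.
by move=> <-; apply: eq_bigr => k _; rewrite natrX.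
Qed.

Lemma apery_a_rec n :
  n.+2%:R ^+ 3 * (apery_a n.+2)%:R - apery_poly n.+1%:R * (apery_a n.+1)%:R
  + n.+1%:R ^+ 3 * (apery_a n)%:R = 0.
Proof.
rewrite !(@apery_aE _ n.+3); try lia.
rewrite !mulr_sumr -sumrB -big_split /=.
under eq_bigr do rewrite apery_certP.
(* Both boundary values vanish: at k = n + 3 because C(n+1, n+2) = 0, at k = 0 by
   [apery_bin_pred]. *)
rewrite telescope_sumr // /apery_cert /= apery_bin_small //.
by rewrite !expr0n /= !mulr0 subr0.
Qed.

Lemma apery_c_diag_step n k :
  apery_c n k.+1 = apery_c n k + (-1) ^+ k / (2 * k.+1%:R ^+ 3 * lam n k.+1).
Proof. by rewrite /apery_c (@big_nat_recr _ _ _ k 0) //= addrA. Qed.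

(** The change of the alternating sum telescopes in k. The case k = 0 is the new term 1/(n+1)^3 of
    the harmonic sum. *)
Lemma apery_c_step n k : (k <= n)%N ->
  apery_c n.+1 k = apery_c n k
    + (-1) ^+ k / (n.+1%:R ^+ 2 * lam n.+1 k * (n%:R + 1 - k%:R)).
Proof.
elim: k => [_|k IHk lt_kn].
  rewrite /apery_c !(@big_geq _ _ _ 0 0) // apery_bin0 !addr0.
  rewrite big_nat_recr //= expr0; congr (_ + _).
  by rewrite subr0 natr1 mulr1 -exprSr div1r.
have n0 : 0 <= n%:R :> R by [].
have k0 : 0 <= k%:R :> R by [].
have nk : k%:R + 1 <= n%:R :> R by rewrite natr1 ler_nat.
have [x_gt0 y_gt0 z_gt0] : [/\ 0 < lam n.+1 k, 0 < lam n.+1 k.+1 & 0 < lam n k.+1].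
  by split; rewrite ltr0n apery_bin_gt0 //; lia.
have E1 := apery_bin_recr n.+1 k; have E2 := apery_bin_recl n k.+1.
rewrite !apery_c_diag_step IHk; last exact: ltnW.
rewrite -[n.+1%:R]natr1 -[k.+1%:R]natr1 in E1 E2 *.
rewrite !exprS.
have F1 : lam n.+1 k.+1 =
    lam n.+1 k * (n%:R + 1 - k%:R) * (n%:R + k%:R + 2) / (k%:R + 1) ^+ 2.
  have d : (k%:R + 1) ^+ 2 != 0 :> R by rewrite expf_neq0 // gt_eqF //; lra.
  by apply: (mulIf d); rewrite mulfVK // E1; ring.
have F2 : lam n k.+1 =
    lam n.+1 k * (n%:R + 1 - k%:R) * (n%:R - k%:R) / (k%:R + 1) ^+ 2.
  have d : n%:R + 1 + (k%:R + 1) != 0 :> R by rewrite gt_eqF //; lra.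
  apply: (mulIf d); rewrite -E2 F1; field; rewrite gt_eqF //; lra.
rewrite F1 F2; field.
by rewrite !gt_eqF //; lra.
Qed.

(** Certificate for b_n, with the same shift in k: that of a_n weighted by [apery_c], plus a
    correction for the variation of [apery_c] with n and k. *)
Definition apery_cert_b n k : R :=
  apery_cert n k * apery_c n k.-1
  + 5 * (2 * n%:R + 1) * (-1) ^+ k * (k%:R - 1) * (apery_bin_pred n k)%:R
    / (n%:R * (n%:R + 1)).

(** Every value of [apery_c] is compared with [C], its value at (n+1, k). The coefficient of [C]
    cancels by [apery_certP]; the differences have the closed forms [H1], [H2], [H3], which leaves a
    rational identity. *)
Lemma apery_cert_bP n k : (k <= n.+1)%N ->
  n.+2%:R ^+ 3 * (lam n.+2 k ^+ 2 * apery_c n.+2 k)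
  - apery_poly n.+1%:R * (lam n.+1 k ^+ 2 * apery_c n.+1 k)
  + n.+1%:R ^+ 3 * (lam n k ^+ 2 * apery_c n k)
  = apery_cert_b n.+1 k.+1 - apery_cert_b n.+1 k.
Proof.
move=> le_k; have [t [E2 E1 E0 Ep]] := apery_bin_param n k.
have Hcert := apery_certP n k.
set C := apery_c n.+1 k; set s : R := (-1) ^+ k.
have n0 : 0 <= n%:R :> R by [].
have k0 : 0 <= k%:R :> R by [].
have nk : k%:R <= n%:R + 1 :> R by rewrite natr1 ler_nat.
have t_neq0 : t != 0.
  have : lam n.+1 k != 0 by rewrite pnatr_eq0 -lt0n apery_bin_gt0.
  by rewrite E1; apply: contraNneq => ->; rewrite !mul0r.
set K : R := 4 * (2 * n.+1%:R + 1) *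
  ((k%:R - 1) * (2 * k%:R - 1) - (2 * n.+1%:R + 1) ^+ 2).
have H1 : apery_cert n.+1 k * (C - apery_c n.+1 k.-1) =
    - s * K * t * k%:R / (2 * (n%:R + 1 + k%:R) * (n%:R + 2 - k%:R)).
  rewrite /apery_cert /= -/K.
  case: k @C @s @K le_k k0 nk E2 E1 E0 Ep {Hcert} => [|k] C s K le_k k0 nk E2 E1 E0 Ep.
    by rewrite /= expr0n !mulr0 !mul0r.
  rewrite Ep /C apery_c_diag_step /= E1 /s (exprS (-1) k).
  rewrite -[k.+1%:R]natr1 in nk *.
  have k0' : 0 <= k%:R :> R by [].
  by field; rewrite t_neq0 !gt_eqF //=; lra.
have H2 : lam n.+2 k ^+ 2 * (apery_c n.+2 k - C) =
    s * t * (n%:R + 1 + k%:R) * (n%:R + 2 + k%:R) / ((n%:R + 2) ^+ 2 * (n%:R + 2 - k%:R)).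
  rewrite apery_c_step // -/C -/s addrC addKr E2 -[n.+2%:R]natr1 -[n.+1%:R]natr1.
  by field; rewrite t_neq0 !gt_eqF //=; lra.
have H3 : lam n k ^+ 2 * (C - apery_c n k) =
    s * t * (n%:R + 1 - k%:R) * (n%:R + 2 - k%:R) / ((n%:R + 1) ^+ 2 * (n%:R + 1 + k%:R)).
  have [le_kn|lt_nk] := leqP k n; last first.
    (* At k = n + 1 both sides are zero, the left through C(n, n+1), the right through n + 1 - k. *)
    have -> : k = n.+1 by lia.
    by rewrite apery_bin_small // expr0n -natr1 subrr mulr0 !mul0r.
  have nk' : k%:R <= n%:R :> R by rewrite ler_nat.
  rewrite /C apery_c_step // -/s addrC addKr E1 E0 -[n.+1%:R]natr1.
  by field; rewrite t_neq0 !gt_eqF //=; lra.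
rewrite /apery_cert_b /= -/C.
rewrite (_ : apery_cert n.+1 k.+1 = n.+2%:R ^+ 3 * lam n.+2 k ^+ 2 -
  apery_poly n.+1%:R * lam n.+1 k ^+ 2 + n.+1%:R ^+ 3 * lam n k ^+ 2 + apery_cert n.+1 k);
  last by rewrite Hcert subrK.
have -> : lam n.+2 k ^+ 2 * apery_c n.+2 k =
  lam n.+2 k ^+ 2 * C + lam n.+2 k ^+ 2 * (apery_c n.+2 k - C) by ring.
have -> : lam n k ^+ 2 * apery_c n k =
  lam n k ^+ 2 * C - lam n k ^+ 2 * (C - apery_c n k) by ring.
have -> : apery_cert n.+1 k * apery_c n.+1 k.-1 =
  apery_cert n.+1 k * C - apery_cert n.+1 k * (C - apery_c n.+1 k.-1) by ring.
rewrite H1 H2 H3 Ep E1 E2 E0 (exprS (-1) k) -/s /K /apery_poly.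
rewrite -[n.+2%:R]natr1 -[n.+1%:R]natr1 -[k.+1%:R]natr1.
by field; rewrite !gt_eqF //=; lra.
Qed.

Lemma apery_b_rec n :
  n.+2%:R ^+ 3 * apery_b n.+2 - apery_poly n.+1%:R * apery_b n.+1
  + n.+1%:R ^+ 3 * apery_b n = 0.
Proof.
rewrite /apery_b !(@apery_sum_widen _ _ n.+3); try lia.
(* [apery_cert_bP] stops at k = n + 1. The term k = n + 2 is split off and cancels against the upper
   boundary value of the certificate. *)
rewrite !mulr_sumr -sumrB -big_split /= big_nat_recr //=.
rewrite (eq_big_nat _ _
  (F2 := fun k => apery_cert_b n.+1 k.+1 - apery_cert_b n.+1 k)); last first.
  by move=> k /andP[_ lt_k]; rewrite apery_cert_bP.
rewrite telescope_sumr //.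
have [t [E2 _ _ Ep]] := apery_bin_param n n.+2.
have Er := apery_bin_recr n.+2 n.+1.
rewrite (@apery_bin_small n.+1 n.+2) // (@apery_bin_small n n.+2) //.
have t_neq0 : t != 0.
  have : lam n.+2 n.+2 != 0 by rewrite pnatr_eq0 -lt0n apery_bin_gt0.
  by rewrite E2; apply: contraNneq => ->; rewrite !mul0r.
have n0 : 0 <= n%:R :> R by [].
rewrite apery_c_diag_step apery_c_step //.
have F : lam n.+2 n.+1 = t * (2 * n%:R + 3) * (n%:R + 2) ^+ 2.
  have d : (n.+2%:R - n.+1%:R) * (n.+2%:R + n.+1%:R + 1) != 0 :> R.
    rewrite -[n.+2%:R]natr1 -[n.+1%:R]natr1 addrC addKr mul1r gt_eqF //; lra.
  apply: (mulIf d); rewrite mulrA -Er E2 -[n.+2%:R]natr1 -[n.+1%:R]natr1; ring.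
rewrite F /apery_cert_b /apery_cert Ep E2 !(exprS (-1)).
rewrite -[n.+2%:R]natr1 -[n.+1%:R]natr1 /=.
set C := apery_c _ _; set s : R := (-1) ^+ n.
by field; rewrite t_neq0 !gt_eqF //=; lra.
Qed.

End AperyRecurrence.

(** * Arithmetic and size of the linear forms a_n zeta(3) - b_n *)

Section AperyEstimates.
Variable R : archiRealFieldType.
Local Notation a n := ((apery_a n)%:R : R).
Local Notation b n := (apery_b R n).
Local Notation lam n k := ((apery_bin n k)%:R : R).
Local Notation l n := ((lcm_upto n)%:R : R).

(** Eliminating the middle terms of the two recurrences shows that (n+1)^3 times the Casoratian is
    constant; a_0 = 1, b_0 = 0 and b_1 = 6 give the value 6. *)
Lemma apery_casoratian n : b n.+1 * a n - b n * a n.+1 = 6 / n.+1%:R ^+ 3.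
Proof.
elim: n => [|n IHn].
  have c00 : apery_c R 0 0 = 0 by rewrite /apery_c !big_geq // addr0.
  have c10 : apery_c R 1 0 = 1.
    by rewrite /apery_c big_nat1 big_geq // addr0 expr1n invr1.
  have c11 : apery_c R 1 1 = 1 + (2 * 2)^-1.
    rewrite apery_c_diag_step c10 expr0 expr1n mulr1 div1r.
    by rewrite (_ : apery_bin 1 1 = 2%N).
  have -> : apery_a 0 = 1%N by rewrite /apery_a big_nat1.
  have -> : b 0 = 0 by rewrite /apery_b big_nat1 c00 mulr0.
  have -> : b 1 = 6.
    rewrite /apery_b big_nat_recr //= big_nat1 c10 c11.
    rewrite (_ : apery_bin 1 1 = 2%N) // (_ : apery_bin 1 0 = 1%N) //.
    by field.
  by rewrite mul0r subr0 mulr1 expr1n divr1.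
have Ha := apery_a_rec R n; have Hb := apery_b_rec R n.
have d1 : n.+1%:R ^+ 3 != 0 :> R by rewrite expf_neq0 // pnatr_eq0.
have d2 : n.+2%:R ^+ 3 != 0 :> R by rewrite expf_neq0 // pnatr_eq0.
apply: (mulIf d2); rewrite mulfVK //.
have : (b n.+1 * a n - b n * a n.+1) * n.+1%:R ^+ 3 = 6 by rewrite IHn mulfVK.
move=> <-; apply/eqP; rewrite -subr_eq0; apply/eqP.
transitivity ((n.+2%:R ^+ 3 * b n.+2 - apery_poly n.+1%:R * b n.+1
  + n.+1%:R ^+ 3 * b n) * a n.+1 - (n.+2%:R ^+ 3 * a n.+2
  - apery_poly n.+1%:R * a n.+1 + n.+1%:R ^+ 3 * a n) * b n.+1); first by ring.
by rewrite Ha Hb !mul0r subr0.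
Qed.

(** * Growth of a_n *)

Lemma apery_a_gt0 n : 0 < a n.
Proof.
rewrite ltr0n /apery_a big_nat_recl //= apery_bin0; exact: ltn_addr.
Qed.

Lemma apery_bin_le n k : (apery_bin n k <= apery_bin n.+1 k)%N.
Proof.
by rewrite /apery_bin addSn leq_mul // leq_bin2l.
Qed.

Lemma apery_a_le n : a n <= a n.+1.
Proof.
rewrite ler_nat /apery_a [X in (_ <= X)%N]big_nat_recr //=.
apply: leq_trans (leq_addr _ _); apply: leq_sum => k _.
by rewrite leq_sqr apery_bin_le.
Qed.

(** Bootstrap on the recurrence: a_(n-1) <= a_n gives a ratio tending to 33, hence at least 32;
    feeding back a_(n-1) <= a_n / 32 raises the limit to 34 - 1/32, above 33. *)
Lemma apery_a_ratio n : (100 <= n)%N -> 33 * a n <= a n.+1.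
Proof.
move=> n_ge.
have cube_gt0 (m : nat) : 0 < m.+1%:R ^+ 3 :> R by rewrite exprn_gt0.
have crude m : (97 <= m)%N -> 32 * a m.+1 <= a m.+2.
  move=> m_ge; have mR : 97 <= m%:R :> R by rewrite ler_nat.
  rewrite -(ler_pM2l (cube_gt0 m.+1)).
  have := apery_a_rec R m; have := apery_a_le m; have := apery_a_gt0 m.+1.
  move: (a m) (a m.+1) (a m.+2) => x y z y_gt0 le_xy rec.
  have -> : m.+2%:R ^+ 3 * z = apery_poly m.+1%:R * y - m.+1%:R ^+ 3 * x by lra.
  have : m.+1%:R ^+ 3 * x <= m.+1%:R ^+ 3 * y by rewrite ler_pM2l.
  suff : 0 <= (apery_poly m.+1%:R - m.+1%:R ^+ 3 - 32 * m.+2%:R ^+ 3) * y by lra.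
  apply: mulr_ge0; last exact: ltW.
  by rewrite -[m.+2%:R]natr1 -[m.+1%:R]natr1 /apery_poly; nra.
case: n n_ge => // m m_ge; case: m m_ge => // m m_ge.
have mR : 98 <= m%:R :> R by rewrite ler_nat; lia.
rewrite -(ler_pM2l (cube_gt0 m.+2)).
have := apery_a_rec R m.+1; have := crude m; have := apery_a_gt0 m.+2.
move: (a m.+1) (a m.+2) (a m.+3) => x y z y_gt0 le_xy rec.
have {}le_xy : 32 * x <= y by apply: le_xy; lia.
have -> : m.+3%:R ^+ 3 * z = apery_poly m.+2%:R * y - m.+2%:R ^+ 3 * x by lra.
have : m.+2%:R ^+ 3 * (32 * x) <= m.+2%:R ^+ 3 * y by rewrite ler_pM2l.
suff : 0 <= (32 * apery_poly m.+2%:R - m.+2%:R ^+ 3 - 32 * 33 * m.+3%:R ^+ 3) * y by lra.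
apply: mulr_ge0; last exact: ltW.
by rewrite -[m.+3%:R]natr1 -[m.+2%:R]natr1 -[m.+1%:R]natr1 /apery_poly; nra.
Qed.

Lemma apery_a_growth n : 33 ^+ n <= 33 ^+ 100 * a n.
Proof.
have a_ge1 k : 1 <= a k by rewrite ler1n -(ltr0n R) apery_a_gt0.
(* Up to index 100 the factor 33^100 suffices, with a_n >= 1. *)
have [lt_n|] := leqP n 100.
  rewrite -[X in X <= _]mulr1; apply: ler_pM; rewrite ?exprn_ge0 //.
  by rewrite ler_weXn2l ?ler1n // ltnW.
move/ltnW/subnK <-; elim: (n - 100)%N => [|k IHk].
  by rewrite ler_peMr // exprn_ge0.
rewrite addSn exprS; apply: le_trans (ler_wpM2l _ IHk) _ => //.
by rewrite mulrCA ler_pM2l ?exprn_gt0 // apery_a_ratio // leq_addl.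
Qed.

(** * Denominators of b_n *)

Lemma lcm_upto_div_int m n : (0 < m <= n)%N -> l n / m%:R \is a Num.int.
Proof.
move=> mn; have /dvdnP[q ->] := dvdn_lcm_upto mn.
by rewrite natrM mulfK ?pnatr_eq0 -?lt0n; [apply: rpred_nat|case/andP: mn].
Qed.

Lemma lcm_upto_mono_int n (x : R) :
  l n * x \is a Num.int -> l n.+1 * x \is a Num.int.
Proof.
have /dvdnP[q ->] := lcm_upto_dvd (leqnSn n).
by rewrite natrM -mulrA => ?; rewrite rpredM // rpred_nat.
Qed.

(* Leibniz harmonic triangle: 1/((m+1) C(n+1,m+1)) = 1/(m C(n,m)) - 1/(m C(n+1,m)). *)
Lemma lcm_upto_bin_int m n : (0 < m <= n)%N ->
  l n / (m%:R * 'C(n, m)%:R) \is a Num.int.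
Proof.
elim: m n => [//|[|m] IHm] n /andP[_ le_mn].
  by rewrite mul1r bin1; apply: lcm_upto_div_int; lia.
case: n le_mn => // n le_mn.
have H1 := lcm_upto_mono_int (IHm n ltac:(lia)).
have H2 := IHm n.+1 ltac:(lia).
have B1 := mul_bin_left n.+1 m.+1; have B2 := mul_bin_down n.+1 m.+1.
have p1 : (0 < 'C(n, m.+1))%N by rewrite bin_gt0; lia.
have p2 : (0 < 'C(n.+1, m.+1))%N by rewrite bin_gt0; lia.
have p3 : (0 < 'C(n.+1, m.+2))%N by rewrite bin_gt0; lia.
rewrite (_ : l n.+1 / _ = l n.+1 / (m.+1%:R * 'C(n, m.+1)%:R)
  - l n.+1 / (m.+1%:R * 'C(n.+1, m.+1)%:R)); first by rewrite rpredB.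
rewrite -mulrBr; congr (_ * _).
have {}B1 : m.+2%:R * 'C(n.+1, m.+2)%:R = (n%:R - m%:R) * 'C(n.+1, m.+1)%:R :> R.
  by rewrite -natrM B1 natrM subSS natrB //; lia.
have {}B2 : 'C(n.+1, m.+1)%:R = (n%:R + 1) * 'C(n, m.+1)%:R / (n%:R - m%:R) :> R.
  have d : n%:R - m%:R != 0 :> R by rewrite subr_eq0 eqr_nat; lia.
  apply: (mulIf d); rewrite mulfVK // natr1 -natrM [RHS]natrM -natrB ?natrM; last by lia.
  by rewrite -!natrM B2 mulnC subSS.
have nm : m%:R + 1 <= n%:R :> R by rewrite natr1 ler_nat; lia.
have m0 : 0 <= m%:R :> R by [].
have : 'C(n, m.+1)%:R != 0 :> R by rewrite pnatr_eq0 -lt0n.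
rewrite B1 B2 -[m.+1%:R]natr1; move: 'C(n, m.+1)%:R => x x0.
by field; rewrite x0 !gt_eqF //; lra.
Qed.

(** Both sides are (n+k)! / (n! j! (k-j)!). This trades C(n+j, j) in a denominator for C(k, j),
    which the lcm can clear. *)
Lemma bin_trinomial n k j : (j <= k)%N ->
  ('C(n + k, k) * 'C(k, j) = 'C(n + k, k - j) * 'C(n + j, j))%N.
Proof.
move=> le_jk.
have E1 := @bin_fact (n + k) k (leq_addl _ _); rewrite addnK in E1.
have E2 := bin_fact le_jk.
have E3 := @bin_fact (n + k) (k - j) ltac:(lia).
have E4 := @bin_fact (n + j) j (leq_addl _ _); rewrite addnK in E4.
have E5 : (n + k - (k - j) = n + j)%N by lia.
rewrite E5 in E3.
have p : (0 < n`! * j`! * (k - j)`!)%N by rewrite !muln_gt0 !fact_gt0.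
apply/eqP; rewrite -(eqn_pmul2r p); apply/eqP.
transitivity ((n + k)`!); [rewrite -E1 -E2|rewrite -E3 -E4]; lia.
Qed.

(** One lcm factor clears each m of the harmonic part. In the alternating part, [bin_trinomial]
    leaves the denominator m * (m C(n,m)) * (m C(k,m)), whose three factors each divide
    lcm(1..n). *)
Lemma apery_b_int n : 2 * l n ^+ 3 * b n \is a Num.int.
Proof.
rewrite /apery_b mulr_sumr big_nat rpred_sum // => k /andP[_ le_kn].
rewrite mulrA mulrDr rpredD //.
  rewrite mulr_sumr big_nat rpred_sum // => j le_jn.
  rewrite (_ : _ * _ = 2 * lam n k ^+ 2 * (l n / j%:R) ^+ 3).
    have D := lcm_upto_div_int le_jn.
    by rewrite rpredM ?rpredX // rpredM ?rpredX ?rpred_nat.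
  by rewrite expr_div_n; ring.
rewrite mulr_sumr big_nat rpred_sum // => j /andP[_ lt_jk].
have lt_jn : (j < n)%N by lia.
have E := bin_trinomial n lt_jk.
have p1 : 'C(n, j.+1)%:R != 0 :> R by rewrite pnatr_eq0 -lt0n bin_gt0.
have p2 : 'C(k, j.+1)%:R != 0 :> R by rewrite pnatr_eq0 -lt0n bin_gt0.
have p3 : 'C(n + j.+1, j.+1)%:R != 0 :> R by rewrite pnatr_eq0 -lt0n bin_gt0 leq_addl.
have p4 : j.+1%:R != 0 :> R by rewrite pnatr_eq0.
rewrite (_ : _ * _ = (-1) ^+ j * lam n k * 'C(n, k)%:R * 'C(n + k, k - j.+1)%:R *
  (l n / j.+1%:R) * (l n / (j.+1%:R * 'C(n, j.+1)%:R)) *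
  (l n / (j.+1%:R * 'C(k, j.+1)%:R))).
  have lk : l n / (j.+1%:R * 'C(k, j.+1)%:R) \is a Num.int.
    have /dvdnP[q ->] := lcm_upto_dvd (le_kn : (k <= n)%N).
    by rewrite natrM -mulrA rpredM ?rpred_nat // lcm_upto_bin_int.
  have lj := lcm_upto_div_int (lt_jn : (0 < j.+1 <= n)%N).
  have ln := lcm_upto_bin_int (lt_jn : (0 < j.+1 <= n)%N).
  do 3 (apply: rpredM => //); do 3 (apply: rpredM; last exact: rpred_nat).
  by rewrite rpredX // rpredN1.
have {}E : 'C(n + k, k)%:R =
    'C(n + k, k - j.+1)%:R * 'C(n + j.+1, j.+1)%:R / 'C(k, j.+1)%:R :> R.
  by apply: (mulIf p2); rewrite mulfVK // -!natrM E.
rewrite /apery_bin !natrM E.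
by rewrite -natr1 in p4 *; field; rewrite p1 p2 p3 p4.
Qed.

(** * Convergence of b_n / a_n *)

Lemma sum_inv_sqr_le n : \sum_(0 <= m < n) (m.+1%:R ^+ 2)^-1 <= 2 :> R.
Proof.
case: n => [|n]; first by rewrite big_geq.
(* Strengthened by -1/(n+1), so that the induction closes. *)
suff : \sum_(0 <= m < n.+1) (m.+1%:R ^+ 2)^-1 <= 2 - n.+1%:R^-1 :> R.
  by move=> /le_trans; apply; rewrite gerBl invr_ge0.
elim: n => [|n IHn]; first by rewrite big_nat1 expr1n invr1; lra.
rewrite big_nat_recr //=; apply: le_trans (lerD IHn (lexx _)) _.
have n0 : 0 <= n%:R :> R by [].
rewrite -[n.+2%:R]natr1 -[n.+1%:R]natr1 -subr_ge0.
rewrite (_ : _ - _ = ((n%:R + 1) * (n%:R + 2) ^+ 2)^-1).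
  by rewrite invr_ge0 mulr_ge0 ?sqr_ge0 //; lra.
by field; rewrite !gt_eqF //=; lra.
Qed.

Local Notation H n := (\sum_(1 <= m < n.+1) (m%:R ^+ 3)^-1 : R).

(** (m+1) C(n+m+1, m+1) = (n+m+1) C(n+m, m), which is at least n + 1. *)
Lemma apery_bin_lower n m : (m < n)%N -> n.+1%:R <= m.+1%:R * lam n m.+1 :> R.
Proof.
move=> lt_mn; rewrite -natrM ler_nat /apery_bin.
have E := mul_bin_diag (n + m).+1 m; rewrite /= -addnS in E.
have p1 : (0 < 'C(n, m.+1))%N by rewrite bin_gt0.
have p2 : (0 < 'C(n + m, m))%N by rewrite bin_gt0 leq_addl.
rewrite mulnCA -E; nia.
Qed.

(** Each alternating term is at most 1/(2 (m+1)^2 (n+1)) in absolute value, and the inverse squares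
    sum to at most 2. *)
Lemma apery_c_near n k : (k <= n)%N -> `|apery_c R n k - H n| <= n.+1%:R^-1.
Proof.
move=> le_kn; rewrite /apery_c addrAC subrr add0r.
apply: le_trans (ler_norm_sum _ _ _) _.
have S := sum_inv_sqr_le k.
apply: (@le_trans _ _
    (\sum_(0 <= m < k) (m.+1%:R ^+ 2)^-1 * (2 * n.+1%:R)^-1)); last first.
  rewrite -mulr_suml invfM mulrA ler_piMl ?invr_ge0 //; lra.
rewrite !big_nat; apply: ler_sum => m /andP[_ lt_mk].
rewrite normrM normrX normrN1 expr1n mul1r normfV -invfM.
have L := apery_bin_lower (leq_trans lt_mk le_kn).
have m0 : 0 < m.+1%:R :> R by [].
have d0 : 0 < m.+1%:R ^+ 2 * (2 * n.+1%:R) :> R by rewrite mulr_gt0 ?exprn_gt0 ?mulr_gt0.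
have le_d : m.+1%:R ^+ 2 * (2 * n.+1%:R) <= 2 * m.+1%:R ^+ 3 * lam n m.+1.
  have -> : 2 * m.+1%:R ^+ 3 * lam n m.+1 =
    m.+1%:R ^+ 2 * (2 * (m.+1%:R * lam n m.+1)) by ring.
  by rewrite ler_pM2l ?exprn_gt0 // ler_pM2l.
have D0 := lt_le_trans d0 le_d.
by rewrite gtr0_norm // lef_pV2.
Qed.

(** b_n / a_n is the mean of the [apery_c n k] with weights [apery_bin n k ^ 2]. *)
Lemma apery_quotient_near n : `|b n / a n - H n| <= n.+1%:R^-1.
Proof.
have a0 := apery_a_gt0 n; have Hc := @apery_c_near n.
move: (H n) Hc => h Hc.
have -> : b n / a n - h = (b n - a n * h) / a n by field; rewrite gt_eqF.
rewrite normrM normfV (gtr0_norm a0) ler_pdivrMr //.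
rewrite (@apery_aE R n n.+1) // /apery_b mulr_suml -sumrB mulr_sumr.
apply: le_trans (ler_norm_sum _ _ _) _.
rewrite !big_nat; apply: ler_sum => k /andP[_ le_kn].
rewrite -mulrBr normrM ger0_norm ?sqr_ge0 // [X in _ <= X]mulrC.
by rewrite ler_wpM2l ?sqr_ge0 // Hc.
Qed.

Lemma apery_quotient_step n :
  b n.+1 / a n.+1 - b n / a n = 6 / (n.+1%:R ^+ 3 * a n * a n.+1).
Proof.
have := apery_casoratian n; have := apery_a_gt0 n; have := apery_a_gt0 n.+1.
set x := b n; set y := b n.+1 => p q E.
have d : n%:R + 1 != 0 :> R by rewrite natr1 pnatr_eq0.
have -> : 6 / (n.+1%:R ^+ 3 * a n * a n.+1) = 6 / n.+1%:R ^+ 3 / (a n * a n.+1).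
  by field; rewrite addrC d !gt_eqF.
by rewrite -E; field; rewrite !gt_eqF.
Qed.

Lemma apery_a_mono m n : (m <= n)%N -> a m <= a n.
Proof.
move/subnK <-; elim: (n - m)%N => [|k IHk]; first exact: lexx.
exact: le_trans IHk (apery_a_le _).
Qed.

(** The increments are positive and, from n on, at most 6 / ((k+1)^2 a_n^2), whence 12 = 6 * 2. The
    lower bound starts at n + 1 to yield a strict inequality at n later. *)
Lemma apery_quotient_bounds n m : (n < m)%N ->
  b n.+1 / a n.+1 <= b m / a m <= b n / a n + 12 / a n ^+ 2.
Proof.
move=> lt_nm.
have an0 := apery_a_gt0 n.
have step_ge0 k : b k / a k <= b k.+1 / a k.+1.
  rewrite -subr_ge0 apery_quotient_step.
  by rewrite divr_ge0 ?mulr_ge0 ?exprn_ge0 ?ler0n.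
apply/andP; split.
  rewrite -(subnK lt_nm); elim: (m - n.+1)%N => [|k IHk]; first exact: lexx.
  exact: le_trans IHk (step_ge0 _).
rewrite -lerBlDl -(telescope_sumr (fun k => b k / a k)) ?(ltnW lt_nm) //.
apply: (@le_trans _ _ (\sum_(n <= k < m) (k.+1%:R ^+ 2)^-1 * (6 / a n ^+ 2))).
  rewrite !big_nat; apply: ler_sum => k /andP[le_nk _].
  rewrite apery_quotient_step mulrCA ler_wpM2l // -invfM.
  have k0 : 0 < k.+1%:R :> R by [].
  have k1 : 1 <= k.+1%:R :> R by rewrite ler1n.
  have ak0 := apery_a_gt0 k.
  have le1 := apery_a_mono le_nk; have le2 := apery_a_mono (leqW le_nk).
  rewrite lef_pV2 ?posrE ?mulr_gt0 ?exprn_gt0 ?apery_a_gt0 //.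
  rewrite -mulrA; apply: ler_pM; rewrite ?exprn_ge0 ?(ltW an0) //.
    by rewrite ler_weXn2l.
  by rewrite expr2; apply: ler_pM => //; exact: ltW.
rewrite -mulr_suml.
have S : \sum_(n <= k < m) (k.+1%:R ^+ 2)^-1 <= 2 :> R.
  apply: le_trans (sum_inv_sqr_le m).
  rewrite [X in _ <= X](@big_cat_nat _ _ _ n) ?(ltnW lt_nm) //= lerDr.
  by rewrite sumr_ge0 // => k _; rewrite invr_ge0 sqr_ge0.
have q0 : 0 <= 6 / a n ^+ 2 by rewrite divr_ge0 ?exprn_ge0 // ltW.
have -> : 12 / a n ^+ 2 = 2 * (6 / a n ^+ 2) by field; rewrite gt_eqF.
by rewrite ler_wpM2r.
Qed.

Lemma le_add_inv (x y : R) N :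
  (forall m, (N <= m)%N -> x <= y + m.+1%:R^-1) -> x <= y.
Proof.
move=> Hxy; rewrite leNgt; apply/negP => lt_yx.
have d0 : 0 < x - y by rewrite subr_gt0.
set m := maxn N (Num.truncn (x - y)^-1).
have := Hxy m (leq_maxl _ _); rewrite leNgt => /negP; apply.
rewrite -ltrBDl -[X in _ < X]invrK ltf_pV2 ?posrE ?invr_gt0 //.
apply: lt_le_trans (truncnS_gt _) _.
by rewrite ler_nat ltnS leq_maxr.
Qed.

Lemma pow_ratio_unbounded (x y K : R) :
  0 < x < y -> ~ (forall n, y ^+ n <= K * x ^+ n).
Proof.
move=> /andP[x0 lt_xy] Hn.
(* Bernoulli's inequality for (y/x)^n, cleared of denominators. *)
have bernoulli n : x ^+ n * (x + n%:R * (y - x)) <= x * y ^+ n.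
  elim: n => [|n IHn]; first by rewrite !expr0; lra.
  have le_pow : x ^+ n <= y ^+ n by rewrite lerXn2r ?nnegrE //; lra.
  have xy0 : 0 <= x * (y - x) by rewrite mulr_ge0 //; lra.
  have := ler_wpM2l xy0 le_pow.
  have := ler_wpM2l (ltW x0) IHn.
  rewrite !exprS -natr1; nra.
have bounded n : n%:R * (y - x) <= x * K.
  have xn0 : 0 < x ^+ n by rewrite exprn_gt0.
  rewrite -(ler_pM2l xn0).
  have := bernoulli n; have := ler_wpM2l (ltW x0) (Hn n); have := mulr_gt0 x0 xn0; lra.
have d0 : 0 < y - x by rewrite subr_gt0.
have := bounded (Num.truncn (x * K / (y - x))).+1.
by rewrite -ler_pdivlMr // leNgt truncnS_gt.
Qed.

(** The hypotheses make z the supremum of the partial sums, so order and the Archimedean property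
    replace limits. *)
Lemma apery_linear_form_bounds (z : R) :
  (forall n, H n <= z) -> (forall y, (forall n, H n <= y) -> z <= y) ->
  forall n, 0 < a n * z - b n <= 12 / a n.
Proof.
move=> Hz z_le n; have a0 := apery_a_gt0 n.
have near m := apery_quotient_near m.
have bounds m := @apery_quotient_bounds n m.
have lo : b n.+1 / a n.+1 <= z.
  apply: (@le_add_inv _ _ n.+1) => m lt_nm.
  have /andP[le1 _] := bounds m lt_nm; have := near m; rewrite ler_norml => /andP[_ le2].
  apply: le_trans le1 _; move: (Hz m) le2.
  by move: (H m) (b m / a m) (m.+1%:R^-1) => h r e; lra.
have hi : z <= b n / a n + 12 / a n ^+ 2.
  apply: z_le => m; apply: (@le_add_inv _ _ (maxn m n.+1)) => k.
  rewrite geq_max => /andP[le_mk lt_nk].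
  have /andP[_ le1] := bounds k lt_nk; have := near k; rewrite ler_norml => /andP[le2 _].
  have le3 : H m <= H k.
    rewrite [X in _ <= X](@big_cat_nat _ _ _ m.+1) //= lerDl.
    by rewrite sumr_ge0 // => i _; rewrite invr_ge0 exprn_ge0.
  apply: le_trans le3 _; apply: le_trans (lerD le1 (lexx _)); move: le2.
  by move: (H k) (b k / a k) (k.+1%:R^-1) => h r e; lra.
have step : 0 < b n.+1 / a n.+1 - b n / a n.
  by rewrite apery_quotient_step divr_gt0 // !mulr_gt0 ?exprn_gt0 ?apery_a_gt0.
have -> : a n * z - b n = a n * (z - b n / a n) by field; rewrite gt_eqF.
have -> : 12 / a n = a n * (12 / a n ^+ 2) by field; rewrite gt_eqF.
by rewrite pmulr_rgt0 // ler_pM2l //; apply/andP; split; move: lo hi step; lra.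
Qed.

(* The ratio 16^3 / 5^3 = 32.768 of the bound on lcm(1..n)^3 is below 33. *)
Lemma apery_irrationality_criterion (z : R) :
  (forall n, 0 < a n * z - b n <= 12 / a n) ->
  forall (p : int) (d : nat), (0 < d)%N -> z = p%:~R / d%:R -> False.
Proof.
move=> Hz p d d_gt0 zE.
have dR : d%:R != 0 :> R by rewrite pnatr_eq0 -lt0n.
have [C HC] := lcm_upto_le.
(* A positive integer is at least 1. *)
have ge1 n : 1 <= 2 * l n ^+ 3 * (d%:R * (a n * z - b n)).
  have l0 : 0 < l n by rewrite ltr0n lcm_upto_gt0.
  have /andP[pos _] := Hz n.
  have X0 : 0 < 2 * l n ^+ 3 * (d%:R * (a n * z - b n)).
    have d0 : 0 < d%:R :> R by rewrite ltr0n.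
    by rewrite !mulr_gt0 ?exprn_gt0.
  suff : 2 * l n ^+ 3 * (d%:R * (a n * z - b n)) \is a Num.int.
    move=> /intrP[m E]; move: X0; rewrite E ltr0z ler1z gtz0_ge1 => ?; assumption.
  have -> : 2 * l n ^+ 3 * (d%:R * (a n * z - b n)) =
    2 * l n ^+ 3 * (a n * p%:~R) - d%:R * (2 * l n ^+ 3 * b n) by rewrite zE; field.
  apply: rpredB; apply: rpredM; rewrite ?rpred_nat ?apery_b_int //.
    by apply: rpredM; rewrite ?rpredX ?rpred_nat.
  by apply: rpredM; rewrite ?rpred_int ?rpred_nat.
have lt_base : 0 < (16 ^+ 3 : R) < 5 ^+ 3 * 33.
  by rewrite exprn_gt0 //=; lra.
(* In the constant, 24 = 2 * 12, the cube of C comes from the lcm bound and 33^100 from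
   [apery_a_growth]. The bases are 16^3 = 4096 and 5^3 * 33 = 4125. *)
apply: (@pow_ratio_unbounded _ _ (24 * d%:R * C%:R ^+ 3 * 33 ^+ 100) lt_base) => n.
have a0 := apery_a_gt0 n.
have {HC} lC : (5 ^+ n * l n) ^+ 3 <= (C%:R * 16 ^+ n) ^+ 3.
  by rewrite lerXn2r ?nnegrE ?mulr_ge0 ?exprn_ge0 // -!natrX -!natrM ler_nat HC.
have G := apery_a_growth n.
have {}ge1 : a n <= 24 * d%:R * l n ^+ 3.
  have /andP[_ le] := Hz n.
  have l0 : 0 <= 2 * l n ^+ 3 * d%:R by rewrite !mulr_ge0 ?exprn_ge0.
  rewrite -[X in X <= _]mul1r -ler_pdivlMr //; apply: le_trans (ge1 n) _.
  have := ler_wpM2l l0 le; rewrite mulrA => /le_trans; apply.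
  by rewrite le_eqVlt; apply/orP; left; apply/eqP; field; rewrite gt_eqF.
have {}G : 33 ^+ n <= 33 ^+ 100 * (24 * d%:R * l n ^+ 3).
  by apply: le_trans G _; rewrite ler_wpM2l // exprn_ge0.
rewrite (exprMn _ (5 ^+ 3)) -!exprM !(mulnC 3) !exprM.
move: lC; rewrite !(exprMn 3) => lC.
have w0 : 0 <= (5 ^+ n) ^+ 3 :> R by rewrite !exprn_ge0.
apply: le_trans (ler_wpM2l w0 G) _.
have k0 : 0 <= 33 ^+ 100 * (24 * d%:R) :> R by rewrite mulr_ge0 ?exprn_ge0 ?mulr_ge0.
have := ler_wpM2l k0 lC.
move: ((5 ^+ n) ^+ 3) ((16 ^+ n) ^+ 3) (l n ^+ 3) (33 ^+ 100) (C%:R ^+ 3) => u v w x y.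
by congr (_ <= _); ring.
Qed.

End AperyEstimates.

(** * Passage to zeta(3) *)

Lemma nondecreasing_cubes (R : realType) :
  nondecreasing_seq (fun N => \sum_(1 <= n < N.+1) (n%:R ^+ 3 : R)^-1).
Proof.
apply/nondecreasing_seqP => n; rewrite [X in _ <= X]big_nat_recr //=.
by rewrite lerDl invr_ge0 exprn_ge0.
Qed.

(** [zeta] is a bare limit, so convergence must be proved: the partial sums increase and stay below
    2, by comparison with inverse squares. *)
Lemma zeta_sum_cvg (R : realType) :
  (fun N => \sum_(1 <= n < N.+1) (n%:R ^+ 3 : R)^-1) @ \oo --> zeta (3 : R).
Proof.
have -> : zeta (3 : R) = limn (fun N => \sum_(1 <= n < N.+1) (n%:R ^+ 3 : R)^-1).
  rewrite /zeta; congr (limn _); apply/funext => N; apply: eq_bigr => n _.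
  by rewrite powRN powR_mulrn.
apply: nondecreasing_is_cvgn; first exact: nondecreasing_cubes.
exists 2 => _ [n _ <-]; apply: le_trans (sum_inv_sqr_le R n).
rewrite big_add1 /=; apply: ler_sum => m _.
rewrite lef_pV2 ?posrE ?exprn_gt0 //.
by rewrite ler_weXn2l // ler1n.
Qed.

Theorem mainTheorem1 (R : realType) :
  (\sum_(1 <= n < N.+1) 1 / (n%:R ^+ 3 : R)) @[N --> \oo] --> zeta (3 : R)
  /\ irrational (zeta (3 : R)).
Proof.
have zcvg := @zeta_sum_cvg R; split.
  by under eq_cvg do under eq_bigr do rewrite div1r.
move=> /= [q _]; have [p d _] := ratP q.
rewrite fmorph_div /= ratr_nat ratr_int => /esym zE.
apply: (@apery_irrationality_criterion R (zeta 3)) zE => //.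
have limE := cvg_lim (@Rhausdorff R) zcvg.
have zis : cvgn (fun N => \sum_(1 <= n < N.+1) (n%:R ^+ 3 : R)^-1).
  by apply/cvg_ex; exists (zeta 3).
(* The limit of the increasing partial sums is their supremum. *)
apply: apery_linear_form_bounds => [n|y Hy].
  by rewrite -limE; apply: (nondecreasing_cvgn_le _ zis); apply: nondecreasing_cubes.
by rewrite -limE; apply: limr_le => //; apply: nearW.
Qed.
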